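(* Let $r \ge 0$ and $m$ be natural numbers such that $2^r < m \leq 2^{r+1}$. The inequality $$2g(x) + \sum_{j=1}^r g(2^j x) + \sum_{\ell = 2^r+1}^m \frac{m}{\ell(\ell-1)} \Bigl( g(\ell x) + g\bigl((2^{r+1}+1-\ell)x\bigr)-g(x)\Bigr) \leq 1,$$ which holds for all $x\in\mathbb{R}$, is an optimal inequality of the form $\sum_{k=1}^m a_k\, g(kx)\leq 1$ (for all $x \in \mathbb{R}$, with real coefficients $a_k$), in the sense that it has the maximal value of $\sum_{k=1}^m a_k$ among all valid inequalities of this form; this maximal value is $r+1+\frac{m}{2^r}$. That is: the coefficients of the displayed inequality sum to $r+1+\frac{m}{2^r}$, and whenever real numbers $a_1,\dots,a_m$ satisfy $\sum_{k=1}^m a_k\, g(kx)\leq 1$ for all $x\in\mathbb{R}$, one has $\sum_{k=1}^m a_k\leq r+1+\frac{m}{2^r}$.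
   Context: The sawtooth (signed fractional part) function $g:\mathbb{R}\to(-1/2,1/2]$ is defined by $g(x) = x - \lceil x-\tfrac12\rceil = x+\lfloor \tfrac12 - x\rfloor$. Empty sums are zero. *)

(* Defs.v *)
From mathcomp Require Import all_boot all_order all_algebra.
From mathcomp Require Import reals.

Set Implicit Arguments.
Unset Strict Implicit.
Unset Printing Implicit Defensive.

Import Order.TTheory GRing.Theory Num.Theory.

Local Open Scope ring_scope.

(* Values lie in ]-1/2, 1/2]; in particular sawtooth (1/2) = 1/2. *)
Definition sawtooth (R : realType) (x : R) : R :=
  x - (Num.ceil (x - 2^-1))%:~R.

(* Only the values a 1, ..., a m matter. *)
Definition sawtooth_comb (R : realType) (m : nat) (a : nat -> R) (x : R) : R :=
  \sum_(1 <= k < m.+1) a k * sawtooth (k%:R * x).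

Definition valid_ineq (R : realType) (m : nat) (a : nat -> R) : Prop :=
  forall x : R, sawtooth_comb m a x <= 1.

(* Coefficient of g(kx), after collecting terms, in
     2 g(x) + \sum_(1 <= j <= r) g(2^j x)
     + \sum_(2^r < l <= m) m / (l (l - 1)) *
         (g(l x) + g((2^(r+1) + 1 - l) x) - g(x)).
   The truncated subtraction is harmless: l <= m <= 2^(r+1). *)
Definition opt_coef (R : realType) (r m k : nat) : R :=
  2 * (k == 1%N)%:R
  + \sum_(1 <= j < r.+1) (k == 2 ^ j)%N%:R
  + \sum_((2 ^ r).+1 <= l < m.+1)
      m%:R / (l%:R * (l%:R - 1))
      * ((k == l)%:R + (k == 2 ^ r.+1 + 1 - l)%N%:R - (k == 1%N)%:R).

(* Main.v *)
Require Import Defs.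
From mathcomp Require Import all_boot all_order all_algebra.
From mathcomp Require Import reals.
From mathcomp Require Import ring lra zify.

Set Implicit Arguments.
Unset Strict Implicit.
Unset Printing Implicit Defensive.

Import Order.TTheory GRing.Theory Num.Theory.

Local Open Scope ring_scope.

(** Put n = 2^r, y = g(x) and t = g(2nx). Since 2 g(x) - g(2x) = [g(x) > 0] - [g(2x) > 0],
    the dyadic part telescopes and the left-hand side becomes
      [y > 0] - [t > 0] + (m/n) t + m \sum_(n < l <= m) E_l / (l (l - 1)),
    with integers E_l = g(lx) + g((2n+1-l)x) - y - t < 2. The only case that is not
    immediate is t <= 0 < y, where one needs \sum E_l / (l (l - 1)) <= -t/n. There the l
    with E_l = 1 lie in runs on which ly is just below a half-integer p + 1/2; as
    1 / (l (l - 1)) = 1/(l-1) - 1/l telescopes, a run contributes at most the difference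
    of the reciprocals of its end points, and these differences are summed over p.

    For optimality, average a valid inequality over the points 1/2, ..., 1/2^(r+1) with
    weight 1 and 1/(2m) with weight m/2^r: each a_k receives total weight exactly 1. *)

(** * The sawtooth as representative modulo 1 *)

Lemma sawtooth_le (R : realType) (x : R) : sawtooth x <= 1 / 2.
Proof. rewrite /sawtooth; have := ceil_ge (x - 2^-1); lra. Qed.

Lemma sawtooth_gt (R : realType) (x : R) : - (1 / 2) < sawtooth x.
Proof. rewrite /sawtooth; have := ceilB1_lt (x - 2^-1); rewrite intrB; lra. Qed.

Lemma sawtooth_rint (R : realType) (x : R) :
  exists z : int, sawtooth x = x - z%:~R.
Proof. by exists (Num.ceil (x - 2^-1)). Qed.

Lemma sawtooth_eq (R : realType) (x y : R) (z : int) :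
  x = y + z%:~R -> - (1 / 2) < y -> y <= 1 / 2 -> sawtooth x = y.
Proof.
move=> -> y1 y2; rewrite /sawtooth (@ceil_def _ _ z); first by lra.
by rewrite intrB; apply/andP; split; lra.
Qed.

Lemma sawtoothDz (R : realType) (x : R) (z : int) :
  sawtooth (x + z%:~R) = sawtooth x.
Proof.
have [w e] := sawtooth_rint x.
apply: (@sawtooth_eq _ _ _ (z + w)); first by rewrite e intrD; lra.
  exact: sawtooth_gt.
exact: sawtooth_le.
Qed.

(** Allows x to be replaced by its representative in ]-1/2, 1/2] inside every g(kx). *)
Lemma sawtooth_nat_mul (R : realType) (k : nat) (x : R) :
  sawtooth (k%:R * sawtooth x) = sawtooth (k%:R * x).
Proof.
have [z ->] := sawtooth_rint x.
rewrite -[RHS](sawtoothDz _ (- (k%:Z * z))); congr sawtooth.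
by rewrite intrN intrM mulrBr.
Qed.

Lemma sawtooth_nat (R : realType) (k : nat) : sawtooth (k%:R : R) = 0.
Proof. by apply: (@sawtooth_eq _ _ _ k%:Z); rewrite ?add0r //; lra. Qed.

Lemma sawtooth_id (R : realType) (x : R) :
  - (1 / 2) < x -> x <= 1 / 2 -> sawtooth x = x.
Proof. by apply: (@sawtooth_eq _ _ _ 0); rewrite addr0. Qed.

(** * Telescoping along powers of two *)

(** With y = g(x), the number 2y leaves ]-1/2, 1/2] exactly when one of y and g(2x) is positive and
    the other is not; the indicators record the resulting shift by 1 or -1. *)
Lemma sawtooth_double (R : realType) (x : R) :
  2 * sawtooth x
  = sawtooth (2 * x) + (0 < sawtooth x)%R%:R - (0 < sawtooth (2 * x))%R%:R.
Proof.
rewrite -(sawtooth_nat_mul 2); move: (sawtooth_gt x) (sawtooth_le x).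
move: (sawtooth x) => y y1 y2.
have [h1|h1] := ltP (1 / 4) y.
  rewrite (@sawtooth_eq _ _ (2 * y - 1) 1); try lra.
  by case: (ltP 0 y); case: (ltP 0 (2 * y - 1)) => /=; lra.
have [h2|h2] := ltP (- (1 / 4)) y.
  rewrite (@sawtooth_eq _ _ (2 * y) 0); try lra.
  by case: (ltP 0 y); case: (ltP 0 (2 * y)) => /=; lra.
rewrite (@sawtooth_eq _ _ (2 * y + 1) (-1)); try lra.
by case: (ltP 0 y); case: (ltP 0 (2 * y + 1)) => /=; lra.
Qed.

Lemma sum_sawtooth_double (R : realType) (r : nat) (x : R) :
  2 * sawtooth x + \sum_(1 <= j < r.+1) sawtooth (2 ^+ j * x)
  = sawtooth (2 ^+ r.+1 * x) + (0 < sawtooth x)%R%:R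
    - (0 < sawtooth (2 ^+ r.+1 * x))%R%:R.
Proof.
elim: r => [|r IH]; first by rewrite big_geq // addr0 expr1 sawtooth_double.
rewrite big_nat_recr //= addrA IH.
have := sawtooth_double (2 ^+ r.+1 * x); rewrite mulrA -exprS; lra.
Qed.

(** * Optimality by averaging *)

(** This is the telescoped identity at x = k / 2^(r+2): x lies in ]0, 1/2], so g(x) = x > 0, while
    g(2^(r+2) x) = g(k) = 0. *)
Lemma sum_sawtooth_dyadic (R : realType) (r k : nat) :
  (0 < k <= 2 ^ r.+1)%N ->
  \sum_(1 <= j < r.+2) sawtooth (k%:R * (2 ^+ j / 2 ^+ r.+2))
    + k%:R / 2 ^+ r.+1 = 1 :> R.
Proof.
move=> /andP[k0 kle]; have e0 : (0 : R) < 2 ^+ r.+1 by rewrite exprn_gt0.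
have hk : (0 : R) < k%:R by rewrite ltr0n.
have hle : k%:R <= 2 ^+ r.+1 :> R by rewrite -natrX ler_nat.
set x : R := k%:R / 2 ^+ r.+2.
have x0 : 0 < x by rewrite divr_gt0 // exprn_gt0.
have x1 : x <= 1 / 2.
  by rewrite /x ler_pdivrMr ?exprn_gt0 // exprS; lra.
have := sum_sawtooth_double r.+1 x.
have -> : 2 ^+ r.+2 * x = k%:R.
  by rewrite /x mulrC divfK // lt0r_neq0 // exprn_gt0.
rewrite sawtooth_nat ltxx sawtooth_id //; last lra.
rewrite x0.
have -> : 2 * x = k%:R / 2 ^+ r.+1.
  by rewrite /x [2 ^+ r.+2]exprS; field; rewrite lt0r_neq0.
under [X in X + _ = 1]eq_bigr => j _.
  rewrite mulrA mulrAC -/x mulrC; over.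
rewrite /=; lra.
Qed.

Lemma sum_coef_le (R : realType) (r m : nat) (a : nat -> R) :
  (0 < m <= 2 ^ r.+1)%N -> valid_ineq m a ->
  \sum_(1 <= k < m.+1) a k <= r%:R + 1 + m%:R / 2 ^+ r.
Proof.
move=> /andP[m0 hm] hv.
have hm0 : (0 : R) < m%:R by rewrite ltr0n.
have e0 : (0 : R) < 2 ^+ r by rewrite exprn_gt0.
have -> : \sum_(1 <= k < m.+1) a k =
  \sum_(1 <= j < r.+2) sawtooth_comb m a (2 ^+ j / 2 ^+ r.+2)
  + m%:R / 2 ^+ r * sawtooth_comb m a (1 / (2 * m%:R)).
  rewrite /sawtooth_comb exchange_big /= mulr_sumr -big_split /=.
  apply: eq_big_nat => k /andP[k0 km].
  rewrite -mulr_sumr mulrCA -mulrDr -[LHS]mulr1; congr (_ * _).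
  rewrite -[LHS](@sum_sawtooth_dyadic _ r k); last by lia.
  congr (_ + _).
  (* Since k <= m, g fixes k / (2m), so the extra point contributes (m / 2^r) (k / (2m)) = k /
     2^(r+1), the term that the dyadic points lack. *)
  have hk : k%:R <= m%:R :> R by rewrite ler_nat.
  have kk0 : (0 : R) < k%:R by rewrite ltr0n.
  rewrite sawtooth_id; first by rewrite exprS; field; rewrite !lt0r_neq0.
    have : 0 <= k%:R * (1 / (2 * m%:R)) :> R by rewrite mulr_ge0 ?divr_ge0 //; lra.
    lra.
  by rewrite mulrA mulr1 ler_pdivrMr; lra.
apply: lerD.
  apply: le_trans (_ : \sum_(1 <= j < r.+2) 1 <= _).
    by apply: ler_sum => j _; exact: hv.
  by rewrite sumr_const_nat subn1 /= natr1.
by rewrite -[leRHS]mulr1 ler_wpM2l // divr_ge0 // ltW.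
Qed.

(** * Sums of the optimal coefficients *)

Lemma invlM_pred (R : realType) (l : nat) : (1 < l)%N ->
  (l%:R * (l%:R - 1))^-1 = (l.-1%:R)^-1 - l%:R^-1 :> R.
Proof.
case: l => [|[|l]] // _; rewrite /= -[l.+2%:R]natr1 addrK.
have h : (0 : R) < l.+1%:R by rewrite ltr0n.
by field; rewrite !lt0r_neq0 //; lra.
Qed.

Lemma sum_invlM_pred (R : realType) (n m : nat) : (0 < n <= m)%N ->
  \sum_(n.+1 <= l < m.+1) m%:R / (l%:R * (l%:R - 1)) = m%:R / n%:R - 1 :> R.
Proof.
move=> /andP[n0 nm].
rewrite (eq_big_nat _ _ (F2 := fun l => m%:R * (l.-1%:R^-1 - l%:R^-1))); last first.
  by move=> l /andP[l1 _]; rewrite invlM_pred //; lia.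
rewrite -mulr_sumr big_add1 /=.
have h : (0 : R) < n%:R by rewrite ltr0n.
have h' : (0 : R) < m%:R by rewrite ltr0n; lia.
rewrite -[X in _ * X]opprK -sumrN.
under eq_bigr => l _ do rewrite opprB.
rewrite telescope_sumr //; field; rewrite !lt0r_neq0 //.
Qed.

Lemma sum_nat_pick (R : realType) (m i : nat) (F : nat -> R) :
  (0 < i <= m)%N -> \sum_(1 <= k < m.+1) (k == i)%:R * F k = F i.
Proof.
move=> h; rewrite (big_rem i) ?mem_index_iota //= eqxx mul1r big1_seq ?addr0 //.
move=> k; rewrite (rem_filter _ (iota_uniq _ _)) mem_filter.
move=> /andP[_ /andP[/= /negbTE ->]].
by rewrite mul0r.
Qed.

(** A general F serves twice: F k = g(kx) recovers the displayed left-hand side, and F = 1 gives the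
    sum of the coefficients. *)
Lemma sum_opt_coef (R : realType) (r m : nat) (F : nat -> R) :
  (2 ^ r < m <= 2 ^ r.+1)%N ->
  \sum_(1 <= k < m.+1) opt_coef R r m k * F k =
  2 * F 1%N + \sum_(1 <= j < r.+1) F (2 ^ j)%N
  + \sum_((2 ^ r).+1 <= l < m.+1)
      m%:R / (l%:R * (l%:R - 1)) * (F l + F (2 ^ r.+1 + 1 - l)%N - F 1%N).
Proof.
move=> /andP[h1 h2]; have n0 : (0 < 2 ^ r)%N by rewrite expn_gt0.
have h3 := expnS 2 r.
under eq_bigr => k _ do rewrite /opt_coef !mulrDl !mulr_suml -mulrA.
rewrite !big_split /= -mulr_sumr sum_nat_pick; last by lia.
congr (_ + _ + _); first (by lra); rewrite exchange_big /=; apply: eq_big_nat => l /andP[l1 l2].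
  rewrite sum_nat_pick // expn_gt0 /=; apply: leq_trans (ltnW h1).
  by rewrite leq_exp2l.
set c := m%:R / _; under eq_bigr => k _ do rewrite -mulrA mulrBl mulrDl.
rewrite -mulr_sumr; congr (_ * _).
by rewrite sumrB big_split /= !sum_nat_pick //; lia.
Qed.

Lemma sum_opt_coef1 (R : realType) (r m : nat) : (2 ^ r < m <= 2 ^ r.+1)%N ->
  \sum_(1 <= k < m.+1) opt_coef R r m k = r%:R + 1 + m%:R / 2 ^+ r.
Proof.
move=> hm; transitivity (\sum_(1 <= k < m.+1) opt_coef R r m k * 1).
  by apply: eq_bigr => k _; rewrite mulr1.
rewrite (sum_opt_coef (fun=> 1) hm) sumr_const_nat subn1 /=.
under [X in _ + X]eq_bigr do rewrite addrK mulr1.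
rewrite sum_invlM_pred ?natrX; first lra.
by rewrite expn_gt0 /= ltnW //; case/andP: hm.
Qed.

(** * Clamped reciprocals *)

(* Its decrease from l - 1 to l is 1 / (l (l - 1)) when a <= l - 1 and l <= b,
   and nonnegative always. *)
Definition inv_clamp (R : realType) (a b z : R) : R :=
  (Num.min (Num.max z a) b)^-1.

Section InvClamp.
Variables (R : realType) (a b : R).
Hypotheses (a0 : 0 < a) (ab : a <= b).

Lemma inv_clamp_id (z : R) : a <= z -> z <= b -> inv_clamp a b z = z^-1.
Proof. by move=> az zb; rewrite /inv_clamp max_l // min_l. Qed.

Let b0 : 0 < b. Proof. exact: lt_le_trans ab. Qed.

Let clamp_gt0 (z : R) : 0 < Num.min (Num.max z a) b.
Proof. by rewrite lt_min lt_max a0 orbT b0. Qed.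

Lemma inv_clamp_ge (z : R) : b^-1 <= inv_clamp a b z.
Proof. by rewrite lef_pV2 ?posrE ?clamp_gt0 // ge_min lexx orbT. Qed.

Lemma inv_clamp_le (z : R) : inv_clamp a b z <= a^-1.
Proof. by rewrite lef_pV2 ?posrE ?clamp_gt0 // le_min le_max lexx orbT. Qed.

(** Here z may lie below a, as the start n of the range of l may for the first run. *)
Lemma inv_clamp_le_inv (z : R) : 0 < z -> z <= b -> inv_clamp a b z <= z^-1.
Proof.
by move=> z0 zb; rewrite lef_pV2 ?posrE ?clamp_gt0 // le_min le_max lexx zb.
Qed.

Lemma inv_clamp_anti (z w : R) : z <= w -> inv_clamp a b w <= inv_clamp a b z.
Proof.
by move=> zw; rewrite lef_pV2 ?posrE ?clamp_gt0 //; apply: le_min2 => //; apply: le_max2.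
Qed.

End InvClamp.

(** * Runs of indices and their total weight *)

(* Here T = - g(2nx), and p is the integer nearest to lx; the bound q./2 <= p
   comes from l > n. *)
Lemma sawtooth_pair_cases (R : realType) (n l q : nat) (x T : R) :
  (n < l <= 2 * n)%N -> 0 < x -> 0 <= T -> T < 1 / 2 ->
  (2 * n)%N%:R * x = q%:R - T ->
  let E := sawtooth (l%:R * x) + sawtooth ((2 * n + 1 - l)%N%:R * x) - x + T in
  E <= 0 \/
  E = 1 /\ exists p : nat, [/\ (q./2 <= p < q)%N,
    p%:R + 1 / 2 - T <= (l%:R - 1) * x & l%:R * x <= p%:R + 1 / 2].
Proof.
move=> /andP[l1 l2] x0 T0 T1 hq /=.
have [c1 e1] := sawtooth_rint (l%:R * x).
have [c2 e2] := sawtooth_rint ((2 * n + 1 - l)%N%:R * x).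
have u1 := sawtooth_le (l%:R * x).
have v1 := sawtooth_le ((2 * n + 1 - l)%N%:R * x).
(* The two arguments add up to (2n+1)x, which makes E an integer. *)
have hl : l%:R * x + (2 * n + 1 - l)%N%:R * x = q%:R - T + x.
  rewrite -mulrDl -natrD -hq; have -> : (l + (2 * n + 1 - l) = 2 * n + 1)%N by lia.
  by rewrite natrD mulrDl mul1r.
set E := (X in X <= 0).
have eE : E = (q%:Z - c1 - c2)%:~R.
  rewrite /E e1 e2 !intrB.
  have -> : (q%:Z)%:~R = q%:R :> R by [].
  lra.
have E1 : (q%:Z - c1 - c2 < 2)%R by rewrite -(ltr_int R) -eE /E; lra.
have [h|h] := lerP (q%:Z - c1 - c2) 0.
  by left; rewrite eE -[0](mulr0z 1) ler_int.
right; have {}h : q%:Z - c1 - c2 = 1 by lia.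
have E2 : E = 1 by rewrite eE h.
split => //.
have l0 : x <= l%:R * x by rewrite -[leLHS]mul1r ler_pM2r // ler1n; lia.
have c0 : (-1 < c1)%R by rewrite -(ltr_int R); lra.
have [p ep] : exists p : nat, c1 = p%:Z by exists `|c1|%N; lia.
have ec : c1%:~R = p%:R :> R by rewrite ep.
rewrite ec in e1.
(* E = 1 and the bound 1/2 on the second sawtooth force g(lx) >= 1/2 + x - T. *)
exists p; have hlo : p%:R + 1 / 2 - T <= (l%:R - 1) * x.
  by move: E2; rewrite /E; lra.
have hhi : l%:R * x <= p%:R + 1 / 2 by lra.
split => //.
(* [k1] uses l <= 2n and gives p < q; [k2] uses l >= n + 1 and gives q < 2p + 2. *)
have k1 : (l%:R - 1) * x <= q%:R - T - x.
  have hl2 : l%:R <= (2 * n)%N%:R :> R by rewrite ler_nat.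
  by have := ler_wpM2r (ltW x0) hl2; lra.
have k2 : q%:R - T + 2 * x <= 2 * (l%:R * x).
  have hl1 : (2 * n)%N%:R + 2 <= 2 * l%:R :> R by rewrite -natrD -natrM ler_nat; lia.
  by have := ler_wpM2r (ltW x0) hl1; lra.
have : (p%:R < q%:R :> R) by lra.
have : (q%:R < (2 * p + 2)%N%:R :> R) by rewrite natrD natrM; lra.
by rewrite !ltr_nat; lia.
Qed.

(* From P (P - T) >= (p - 1/4) (p + 3/4), where P = p + 1/2. *)
Lemma clamp_width_le (R : realType) (p : nat) (x T : R) :
  (0 < p)%N -> 0 < x -> 0 <= T -> T < 1 / 2 ->
  ((p%:R + 1 / 2 - T) / x)^-1 - ((p%:R + 1 / 2) / x)^-1 <=
  x * T * ((p%:R - 1 / 4)^-1 - (p.+1%:R - 1 / 4)^-1).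
Proof.
move=> p0 x0 T0 T1; have hp : 1 <= p%:R :> R by rewrite ler1n.
rewrite -[p.+1%:R]natr1; set P : R := p%:R in hp *.
have -> : ((P + 1 / 2 - T) / x)^-1 - ((P + 1 / 2) / x)^-1 =
  x * T * ((P + 1 / 2) * (P + 1 / 2 - T))^-1.
  by field; rewrite !lt0r_neq0 //; lra.
have -> : (P - 1 / 4)^-1 - (P + 1 - 1 / 4)^-1 = ((P - 1 / 4) * (P + 3 / 4))^-1.
  by field; rewrite !lt0r_neq0 //; lra.
apply: ler_wpM2l; first by rewrite mulr_ge0 // ltW.
by rewrite lef_pV2 ?posrE; try apply: mulr_gt0; try lra; nra.
Qed.

(** The clamping interval is the run of p: by [sawtooth_pair_cases] it contains l - 1 and l whenever
    E_l = 1 with nearest integer p. *)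
Definition run_potential (R : realType) (x T : R) (p : nat) : R -> R :=
  inv_clamp ((p%:R + 1 / 2 - T) / x) ((p%:R + 1 / 2) / x).

(** Runs are bounded by their full width, and [clamp_width_le] telescopes in p; the result is
    compared with T/n = 2xT / (q - T). M is free because only the lower bound of the potential is
    used there. *)
Lemma sum_run_potential_le (R : realType) (n q : nat) (x T M : R) :
  (0 < n)%N -> 0 < x -> 0 <= T -> T < 1 / 2 ->
  (2 * n)%N%:R * x = q%:R - T ->
  \sum_(q./2 <= p < q) (run_potential x T p n%:R - run_potential x T p M)
  <= T / n%:R.
Proof.
move=> n0 x0 T0 T1; rewrite natrM => hq.
set phi := run_potential x T.
have hn : 0 < n%:R :> R by rewrite ltr0n.
have hnx : 0 < n%:R * x by rewrite mulr_gt0.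
have en : n%:R = (q%:R - T) / (2 * x) by rewrite -hq; field; rewrite lt0r_neq0.
have q0 : (0 < q)%N by rewrite -(ltr0n R); lra.
have a0 (p : nat) : 0 < (p%:R + 1 / 2 - T) / x.
  by apply: divr_gt0 => //; have := ler0n R p; lra.
have ab (p : nat) : (p%:R + 1 / 2 - T) / x <= (p%:R + 1 / 2) / x.
  by rewrite ler_pM2r ?invr_gt0 //; lra.
have step (p : nat) : (0 < p)%N -> phi p n%:R - phi p M <=
    x * T * (- (p.+1%:R - 1 / 4)^-1 - - (p%:R - 1 / 4)^-1).
  move=> p0; rewrite opprK [X in _ * X]addrC; apply: le_trans (clamp_width_le p0 x0 T0 T1).
  by apply: lerB; [exact: inv_clamp_le | exact: inv_clamp_ge].
have steps (c d : nat) : (0 < c <= d)%N ->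
    \sum_(c <= p < d) (phi p n%:R - phi p M) <=
    x * T * ((c%:R - 1 / 4)^-1 - (d%:R - 1 / 4)^-1).
  move=> /andP[c0 cd].
  rewrite [X in _ * X]addrC -[X in _ * (_ + X)]opprK.
  rewrite -(telescope_sumr (fun p => - (p%:R - 1 / 4)^-1)) // mulr_sumr.
  by apply: ler_sum_nat => p /andP[cp _]; apply: step; lia.
have xT : 0 <= x * T by rewrite mulr_ge0 // ltW.
have eoq := odd_double_half q.
have S0 := ler0n R q./2.
case: (boolP (odd q)) => oq; rewrite ?oq ?(negbTE oq) /= in eoq.
  have eqR : q%:R = 2 * (q./2)%:R + 1 :> R.
    by rewrite -[in LHS]eoq -muln2 natrD natrM; lra.
  (* The run p = q./2 is centred at (2n + 1) / 2, so only its upper half counts: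
     it is bounded from 1/n rather than from its left end point. *)
  rewrite big_ltn; last by lia.
  set S := q./2%:R in S0 eqR *.
  have h1 : phi q./2 n%:R - phi q./2 M <= n%:R^-1 - ((S + 1 / 2) / x)^-1.
    apply: lerB; last exact: inv_clamp_ge.
    by apply: inv_clamp_le_inv => //; rewrite ler_pdivlMr // /S; lra.
  have h2 := steps (q./2).+1 q ltac:(lia).
  apply: le_trans (lerD h1 h2) _.
  rewrite en -[(q./2).+1%:R]natr1 -/S eqR.
  rewrite -subr_ge0.
  (* The factor S shows that the bound is an equality when q = 1. *)
  have -> : T / ((2 * S + 1 - T) / (2 * x)) -
    (((2 * S + 1 - T) / (2 * x))^-1 - ((S + 1 / 2) / x)^-1 +
      x * T * ((S + 1 - 1 / 4)^-1 - (2 * S + 1 - 1 / 4)^-1)) =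
    x * T * (S * (4 * (S + 3 / 4) * (2 * S + 3 / 4) - (2 * S + 1) * (2 * S + 1 - T))
    / ((2 * S + 1) * (2 * S + 1 - T) * (S + 3 / 4) * (2 * S + 3 / 4))).
    by field; rewrite !lt0r_neq0 //; lra.
  apply: mulr_ge0 => //; apply: divr_ge0; last by rewrite !mulr_ge0; lra.
  by apply: mulr_ge0 => //; nra.
have eqR : q%:R = 2 * (q./2)%:R :> R.
  by rewrite -[in LHS]eoq -muln2 natrM; lra.
have S1 : 1 <= q./2%:R :> R by rewrite ler1n; lia.
have h2 := steps q./2 q ltac:(lia).
apply: le_trans h2 _; rewrite en eqR.
set S := q./2%:R in S0 S1 eqR *.
rewrite -subr_ge0.
have -> : T / ((2 * S - T) / (2 * x)) -
    x * T * ((S - 1 / 4)^-1 - (2 * S - 1 / 4)^-1) =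
    x * T * ((2 * (S - 1 / 4) * (2 * S - 1 / 4) - S * (2 * S - T)) /
      ((2 * S - T) * (S - 1 / 4) * (2 * S - 1 / 4))).
  by field; rewrite !lt0r_neq0 //; lra.
apply: mulr_ge0 => //; apply: divr_ge0; last by rewrite !mulr_ge0; lra.
nra.
Qed.

(** Each l is charged to the decrease from l - 1 to l of all the potentials: no decrease is
    negative, and if E_l = 1 the potential of its own p already pays the weight 1 / (l (l - 1)). *)
Lemma sum_sawtooth_pair_le (R : realType) (n m : nat) (x : R) :
  (0 < n <= m)%N -> (m <= 2 * n)%N -> 0 < x ->
  sawtooth ((2 * n)%N%:R * x) <= 0 ->
  \sum_(n.+1 <= l < m.+1) (l%:R * (l%:R - 1))^-1 *
     (sawtooth (l%:R * x) + sawtooth ((2 * n + 1 - l)%N%:R * x) - x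
      - sawtooth ((2 * n)%N%:R * x))
  <= - sawtooth ((2 * n)%N%:R * x) / n%:R.
Proof.
move=> /andP[n0 nm] m2 x0.
have [z ez] := sawtooth_rint ((2 * n)%N%:R * x).
move: (sawtooth_gt ((2 * n)%N%:R * x)); set t := sawtooth _ in ez *.
have [T et] : exists T, t = - T by exists (- t); rewrite opprK.
rewrite et in ez * => T1 T0.
have hN : 0 <= (2 * n)%N%:R * x by rewrite mulr_ge0 // ltW.
have [q eq] : exists q : nat, z = q%:Z.
  have : (-1 < z)%R by rewrite -(ltr_int R); lra.
  by exists `|z|%N; lia.
have hq : (2 * n)%N%:R * x = q%:R - T.
  have : z%:~R = q%:R :> R by rewrite eq.
  by lra.
have {}T0 : 0 <= T by lra.
have {}T1 : T < 1 / 2 by lra.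
rewrite opprK.
apply: le_trans (sum_run_potential_le m%:R n0 x0 T0 T1 hq).
set phi := run_potential x T.
have a0 (p : nat) : 0 < (p%:R + 1 / 2 - T) / x.
  by apply: divr_gt0 => //; have := ler0n R p; lra.
have ab (p : nat) : (p%:R + 1 / 2 - T) / x <= (p%:R + 1 / 2) / x.
  by rewrite ler_pM2r ?invr_gt0 //; lra.
have -> : \sum_(q./2 <= p < q) (phi p n%:R - phi p m%:R) =
  \sum_(n.+1 <= l < m.+1) \sum_(q./2 <= p < q) (phi p l.-1%:R - phi p l%:R).
  rewrite exchange_big /=; apply: eq_bigr => p _.
  rewrite big_add1 /=.
  under eq_bigr => l _ do rewrite -opprB.
  by rewrite sumrN telescope_sumr // opprB.
apply: ler_sum_nat => l /andP[l1 l2].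
have hnn (p : nat) : 0 <= phi p l.-1%:R - phi p l%:R.
  by rewrite subr_ge0; apply: inv_clamp_anti => //; rewrite ler_nat leq_pred.
have hl0 : 1 < l%:R :> R by rewrite ltr1n; lia.
have [] := @sawtooth_pair_cases R n l q x T _ x0 T0 T1 hq; first by lia.
  move=> h; apply: (@le_trans _ _ 0); last exact: sumr_ge0.
  by rewrite mulr_ge0_le0 // invr_ge0 mulr_ge0; lra.
move=> [-> [p [hp p1 p2]]]; rewrite mulr1.
rewrite (big_rem p) ?mem_index_iota //=.
rewrite -[leLHS]addr0; apply: lerD; last exact: sumr_ge0.
have el : l.-1%:R = l%:R - 1 :> R by rewrite -subn1 natrB //; lia.
rewrite invlM_pred; last by lia.
have lx : (l%:R - 1) * x <= l%:R * x by nra.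
rewrite /phi /run_potential !inv_clamp_id // ?el ?ler_pdivrMr ?ler_pdivlMr //; lra.
Qed.

(** * Validity of the inequality *)

Lemma opt_ineq (R : realType) (r m : nat) (x : R) : (2 ^ r < m <= 2 ^ r.+1)%N ->
  2 * sawtooth x + \sum_(1 <= j < r.+1) sawtooth (2 ^+ j * x)
  + \sum_((2 ^ r).+1 <= l < m.+1) m%:R / (l%:R * (l%:R - 1))
      * (sawtooth (l%:R * x) + sawtooth ((2 ^ r.+1 + 1 - l)%N%:R * x)
         - sawtooth x) <= 1.
Proof.
move=> /andP[nm mN].
have n0 : (0 < 2 ^ r)%N by rewrite expn_gt0.
rewrite sum_sawtooth_double -natrX.
rewrite expnS in mN *; move: (2 ^ r)%N n0 nm mN => n n0 nm mN.
rewrite -(sawtooth_nat_mul (2 * n)).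
under eq_bigr => l _ do
  rewrite -(sawtooth_nat_mul l) -(sawtooth_nat_mul (2 * n + 1 - l)).
move: (sawtooth_gt x) (sawtooth_le x); move: (sawtooth x) => y y1 y2.
set t := sawtooth ((2 * n)%N%:R * y).
have t1 : - (1 / 2) < t := sawtooth_gt _.
have t2 : t <= 1 / 2 := sawtooth_le _.
pose E l := sawtooth (l%:R * y) + sawtooth ((2 * n + 1 - l)%N%:R * y) - y - t.
pose w l : R := m%:R / (l%:R * (l%:R - 1)).
have hn : 0 < n%:R :> R by rewrite ltr0n.
have hm : n%:R < m%:R :> R by rewrite ltr_nat.
have hm2 : m%:R <= 2 * n%:R :> R by rewrite -natrM ler_nat.
have sw := @sum_invlM_pred R n m ltac:(lia).
have W1 : m%:R / n%:R <= 2 :> R by rewrite ler_pdivrMr.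
have W0 : 1 <= m%:R / n%:R :> R by rewrite ler_pdivlMr // mul1r ltW.
(* The weights sum to m/n - 1, so extracting t from each term raises its total coefficient to
   m/n. *)
have -> : \sum_(n.+1 <= l < m.+1) w l *
   (sawtooth (l%:R * y) + sawtooth ((2 * n + 1 - l)%N%:R * y) - y) =
   (m%:R / n%:R - 1) * t + \sum_(n.+1 <= l < m.+1) w l * E l.
  rewrite -sw mulr_suml -big_split /=; apply: eq_bigr => l _.
  by rewrite /w /E; ring.
have Eint l : (n < l <= m)%N -> exists z : int, E l = z%:~R.
  move=> /andP[l1 l2].
  have [c1 e1] := sawtooth_rint (l%:R * y).
  have [c2 e2] := sawtooth_rint ((2 * n + 1 - l)%N%:R * y).
  have [c3 e3] := sawtooth_rint ((2 * n)%N%:R * y).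
  exists (c3 - c1 - c2); rewrite /E /t e1 e2 e3 !intrB natrB; last by lia.
  by rewrite natrD; ring.
(* Both sawtooth values are at most 1/2, so E l <= 1 - y - t < k + 1, and E l is an integer. *)
have Ele l (k : int) : (n < l <= m)%N -> - y - t < k%:~R -> E l <= k%:~R.
  move=> /Eint[z ez] hk; rewrite ez ler_int -ltzD1 addrC -(ltr_int R) -ez intrD.
  have := sawtooth_le (l%:R * y); have := sawtooth_le ((2 * n + 1 - l)%N%:R * y).
  by rewrite /E; lra.
have w0 l : (n < l)%N -> 0 <= w l.
  move=> nl; have : 1 <= l%:R :> R by rewrite ler1n; lia.
  by move=> l1; rewrite divr_ge0 ?mulr_ge0 //; lra.
have sumE (k : int) : - y - t < k%:~R ->
    \sum_(n.+1 <= l < m.+1) w l * E l <= (m%:R / n%:R - 1) * k%:~R.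
  move=> hk; rewrite -sw mulr_suml; apply: ler_sum_nat => l /andP[l1 l2].
  by apply: ler_wpM2l; [exact: w0 | apply: Ele => //; lia].
have [y0|y0] := ltP 0 y; have [t0|t0] := ltP 0 t => /=.
- by have := sumE 0 ltac:(lra); nra.
(* The tight case: the bound -t/n, multiplied by m, exactly cancels (m/n) t. *)
- have h := @sum_sawtooth_pair_le R n m y ltac:(lia) mN y0 t0.
  have -> : \sum_(n.+1 <= l < m.+1) w l * E l = m%:R *
     \sum_(n.+1 <= l < m.+1) (l%:R * (l%:R - 1))^-1 * E l.
    by rewrite mulr_sumr; apply: eq_bigr => l _; rewrite mulrA.
  have m0 : 0 <= m%:R :> R by lra.
  have := ler_wpM2l m0 h.
  have -> : m%:R * (- t / n%:R) = - (m%:R / n%:R * t) by ring.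
  by rewrite -/t -/(E _); lra.
(* For y <= 0 the crude bound E l <= 1 suffices, because m/n <= 2 and t <= 1/2. *)
- by have := sumE 1 ltac:(lra); nra.
- by have := sumE 1 ltac:(lra); nra.
Qed.

Theorem mainTheorem3 (R : realType) (r m : nat)
    (hm : (2 ^ r < m <= 2 ^ r.+1)%N) :
  [/\ (forall x : R,
         2 * sawtooth x
         + \sum_(1 <= j < r.+1) sawtooth (2 ^+ j * x)
         + \sum_((2 ^ r).+1 <= l < m.+1)
             m%:R / (l%:R * (l%:R - 1))
             * (sawtooth (l%:R * x)
                + sawtooth ((2 ^ r.+1 + 1 - l)%N%:R * x)
                - sawtooth x)
         <= 1),
      (forall x : R,
         sawtooth_comb m (opt_coef R r m) x
         = 2 * sawtooth x
           + \sum_(1 <= j < r.+1) sawtooth (2 ^+ j * x)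
           + \sum_((2 ^ r).+1 <= l < m.+1)
               m%:R / (l%:R * (l%:R - 1))
               * (sawtooth (l%:R * x)
                  + sawtooth ((2 ^ r.+1 + 1 - l)%N%:R * x)
                  - sawtooth x)),
      \sum_(1 <= k < m.+1) opt_coef R r m k
        = r%:R + 1 + m%:R / 2 ^+ r
    & forall a : nat -> R, valid_ineq m a ->
        \sum_(1 <= k < m.+1) a k <= r%:R + 1 + m%:R / 2 ^+ r].
Proof.
split.
- by move=> x; exact: opt_ineq.
- move=> x; rewrite /sawtooth_comb (sum_opt_coef (fun k => sawtooth (k%:R * x)) hm).
  by rewrite mul1r; under eq_bigr => j _ do rewrite natrX.
- exact: sum_opt_coef1.
- by move=> a; apply: sum_coef_le; lia.
Qed.
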